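(* Consider the multi-class reusable-resource system with $C\ge1$ units, $M\ge1$ classes and regular valuation distributions. For each $j$ let $\bar\lambda^j\in\arg\max_{\lambda\in[0,\Lambda_j]}\lambda p^j(\lambda)$. Then the static revenue maximization problem $$\max_{\lambda^j\in[0,\bar\lambda^j],\ j=1,\dots,M}\ \mathcal R^{sta}(\lambda^1,\dots,\lambda^M):=\left(\sum_{j=1}^M\lambda^jp^j(\lambda^j)\right)\cdot\frac{\sum_{i=0}^{C-1}\frac1{i!}\left(\sum_{j=1}^M\frac{\lambda^j}{\mu^j}\right)^i}{\sum_{i=0}^{C}\frac1{i!}\left(\sum_{j=1}^M\frac{\lambda^j}{\mu^j}\right)^i}$$ is a concave fractional program.
   Context: There are $M$ customer classes; class $j$ has Poisson arrival rate $\Lambda_j>0$, mean service time $1/\mu^j\in(0,\infty)$, and valuation CDF $F_j$ with density $f_j$, where $F_j$ has interval support $[\underline v_j,\bar v_j]\subseteq\mathbb R_+$ ($\bar v_j$ may be $\infty$) and is continuously differentiable with $f_j>0$ on $(\underline v_j,\bar v_j)$. For $\lambda\in(0,\Lambda_j)$, $p^j(\lambda)$ is the unique price in $(\underline v_j,\bar v_j)$ with $\Lambda_j(1-F_j(p^j(\lambda)))=\lambda$; $p^j(\Lambda_j)=\underline v_j$, $p^j(0)=\bar v_j$; if $\bar v_j=\infty$ the value of $\lambda p^j(\lambda)$ at $\lambda=0$ is its limit as $\lambda\to0$. $F_j$ is regular if $x-\frac{1-F_j(x)}{f_j(x)}$ is non-decreasing in $x$, equivalently $\lambda p^j(\lambda)$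 is concave on $[0,\Lambda_j]$. A concave fractional program is the maximization of a ratio $N/D$ over a convex set, where on that set $N$ is concave and non-negative and $D$ is convex and positive. Here the ratio is $N(\lambda^1,\dots,\lambda^M)=\sum_j\lambda^jp^j(\lambda^j)$ over $D(\lambda^1,\dots,\lambda^M)=Q_C\big(\sum_j\lambda^j/\mu^j\big)$, with $Q_C(\omega)=\frac{\sum_{i=0}^{C}\omega^i/i!}{\sum_{i=0}^{C-1}\omega^i/i!}$ the reciprocal of the service level. *)

(* Defs.v *)
From HB Require Import structures.
From mathcomp Require Export all_boot all_order all_algebra.
From mathcomp Require Export all_classical all_reals all_analysis.

Set Implicit Arguments.
Unset Strict Implicit.
Unset Printing Implicit Defensive.

Export Order.TTheory GRing.Theory Num.Theory.
Export numFieldNormedType.Exports.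

Local Open Scope classical_set_scope.
Local Open Scope ring_scope.

(* [vlow] and [vhigh] are the end points of the support; [vhigh] may be +oo.
   Together, [cdf_low], [cdf_high] and the positivity of the density in between
   say that the support of the distribution is exactly [vlow, vhigh].
   The Poisson dynamics enter the static problem only through the arrival rate
   and the service rate (the reciprocal of the mean service time). *)
Record customer_class (R : realType) := CustomerClass {
  arrival_rate : R;
  service_rate : R;
  val_cdf : cumulativeBounded (0 : R) (1 : R);
  val_pdf : R -> R;
  vlow : R;
  vhigh : \bar R;
  arrival_rate_gt0 : 0 < arrival_rate;
  service_rate_gt0 : 0 < service_rate;
  vlow_ge0 : 0 <= vlow;
  vlow_lt_vhigh : (vlow%:E < vhigh)%E;
  pdf_ge0 : forall x, 0 <= val_pdf x;
  pdf_measurable : measurable_fun [set: R] val_pdf;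
  cdf_pdf : forall x,
    (val_cdf x)%:E = (\int[lebesgue_measure]_(t in `]-oo, x]) (val_pdf t)%:E)%E;
  cdf_low : forall x, x <= vlow -> val_cdf x = 0;
  cdf_high : forall x, (vhigh <= x%:E)%E -> val_cdf x = 1;
  cdf_derive : forall x, vlow < x -> (x%:E < vhigh)%E ->
    is_derive x (1 : R) (val_cdf : R -> R) (val_pdf x);
  pdf_continuous : forall x, vlow < x -> (x%:E < vhigh)%E ->
    {for x, continuous val_pdf};
  pdf_gt0 : forall x, vlow < x -> (x%:E < vhigh)%E -> 0 < val_pdf x
}.

Definition virtual_value (R : realType) (K : customer_class R) (x : R) : R :=
  x - (1 - val_cdf K x) / val_pdf K x.

Definition regular (R : realType) (K : customer_class R) : Prop :=
  forall x y, vlow K < x -> x <= y -> (y%:E < vhigh K)%E ->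
    virtual_value K x <= virtual_value K y.

(* For 0 < l < arrival_rate K, exactly one x satisfies the condition below, so
   the default value of [xget] is never used. *)
Definition price (R : realType) (K : customer_class R) (l : R) : \bar R :=
  if l == 0 then vhigh K
  else if l == arrival_rate K then (vlow K)%:E
  else (xget 0 [set x : R | [/\ vlow K < x, (x%:E < vhigh K)%E
                              & arrival_rate K * (1 - val_cdf K x) = l]])%:E.

(* The revenue rate l * price K l. When the price at 0 is +oo, the value at 0 is
   the limit from the right, which need not be 0 (e.g. for F(x) = 1 - 1/x). *)
Definition revenue (R : realType) (K : customer_class R) (l : R) : R :=
  if (l == 0) && (vhigh K == +oo%E) then
    lim ((fun x : R => x * fine (price K x)) @ 0^'+)
  else l * fine (price K l).

Definition is_argmax (R : realType) (A : set R) (g : R -> R) (x : R) : Prop :=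
  A x /\ forall y, A y -> g y <= g x.

Definition exp_sum (R : realType) (n : nat) (w : R) : R :=
  \sum_(0 <= i < n) w ^+ i / i`!%:R.

Definition QC (R : realType) (C : nat) (w : R) : R :=
  exp_sum C.+1 w / exp_sum C w.

Definition load (R : realType) (M : nat) (K : 'I_M -> customer_class R)
    (l : 'rV[R]_M) : R :=
  \sum_(j < M) l 0 j / service_rate (K j).

Definition total_revenue (R : realType) (M : nat) (K : 'I_M -> customer_class R)
    (l : 'rV[R]_M) : R :=
  \sum_(j < M) revenue (K j) (l 0 j).

Definition static_revenue (R : realType) (C M : nat)
    (K : 'I_M -> customer_class R) (l : 'rV[R]_M) : R :=
  total_revenue K l * (exp_sum C (load K l) / exp_sum C.+1 (load K l)).

Definition concave_function (R : realType) (E : lmodType R)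
    (A : set (convex_lmodType E)) (g : E -> R) : Prop :=
  convex_function A (fun x => - g x).

(* The maximization over A of [obj], presented as the ratio num / den. *)
Record concave_fractional_program (R : realType) (E : lmodType R) (A : set E)
    (obj num den : E -> R) : Prop := ConcaveFractionalProgram {
  cfp_ratio : forall x, A x -> obj x = num x / den x;
  cfp_convex_set : convex_set (A : set (convex_lmodType E));
  cfp_num_concave : concave_function A num;
  cfp_num_ge0 : forall x, A x -> 0 <= num x;
  cfp_den_convex : convex_function (A : set (convex_lmodType E)) den;
  cfp_den_gt0 : forall x, A x -> 0 < den x
}.

(* Main.v *)
Require Import Defs.
From mathcomp Require Import ring lra.

Set Implicit Arguments.
Unset Strict Implicit.
Unset Printing Implicit Defensive.

Local Open Scope classical_set_scope.
Local Open Scope ring_scope.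

(* Both concavity claims are proved by exhibiting supporting lines.

   Denominator: with r_n = exp_sum n / exp_sum n.+1 (one minus the Erlang loss
   probability with n servers), Q_n = 1 / r_n and r_n' = r_n (r_(n-1) - r_n), so
   Q_n' = 1 - r_(n-1) / r_n, and Q_n' is non-decreasing because n |-> r_n is
   concave. That concavity follows by induction from the Erlang recursion
   r_(n+1) = (n+1) / (n+1 + w (1 - r_n)).

   Numerator: parametrize by the price x instead of the rate l = L (1 - F x).
   The derivative in x of L (1 - F x) (x - s) is - L f(x) (phi(x) - s), where
   phi is the virtual value; as phi is non-decreasing, for s = phi(p) the maximum
   is attained at x = p. This is the supporting line of l * p(l) with slope
   phi(p), without differentiating the inverse demand p(l). *)

(** * Polynomial inequalities behind the Erlang recursion *)

(* With [m = n.+1] and [d = m + w * (1 - r_n)], i.e. [r_(n+1) = m / d], the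
   difference [2 r_(n+1) - r_n - r_(n+2)] is a nonnegative multiple of this
   polynomial. It is nonnegative because [d] stays to the right of its larger
   root, which is why the vertex is tracked along the induction too; one step of
   the recursion is [m, d |-> m + 1, m + 1 + w - w * m / d]. *)
Definition erlang_quadratic (R : realFieldType) (m w d : R) : R :=
  (m + 1 + w) * d ^+ 2 - w * (3 * m + 2 + w) * d + 2 * m * w ^+ 2.

(** Multiplied by [d], the conclusion becomes [key], with [c] the collected coefficient of [d]; the
    vertex bound on [d] then leaves a polynomial inequality in [m] and [w] alone. *)
Lemma erlang_quadratic_vertex_step (R : realFieldType) (m w d : R) :
  1 <= m -> 0 < w -> 0 < d ->
  w * (3 * m + 2 + w) <= 2 * (m + 1 + w) * d ->
  w * (3 * (m + 1) + 2 + w) <= 2 * (m + 2 + w) * (m + 1 + w - w * m / d).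
Proof.
move=> m1 w0 d0 V.
set c := 2 * m ^+ 2 + 6 * m + 4 + m * w + w + w ^+ 2.
have c0 : 0 < c by rewrite /c; nra.
have key : 2 * (m + 2 + w) * w * m <= d * c.
  rewrite -(ler_pM2l (_ : 0 < 2 * (m + 1 + w))); last by lra.
  rewrite [leRHS]mulrA; apply: le_trans (_ : w * (3 * m + 2 + w) * c <= _); last first.
    by rewrite ler_wpM2r// ltW.
  rewrite -subr_ge0 [leRHS](_ : _ = w * ((w - m) ^+ 2 * (w + 2 * m)
    + (m * 16 + 8 + w * 6) + (10 * m ^+ 2 + 3 * w ^+ 2 - m * w))); last by rewrite /c; ring.
  apply: mulr_ge0; first lra.
  apply: addr_ge0; last nra.
  by apply: addr_ge0; [apply: mulr_ge0; [exact: sqr_ge0|lra]|lra].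
rewrite -(ler_pM2r d0).
have -> : 2 * (m + 2 + w) * (m + 1 + w - w * m / d) * d =
  2 * (m + 2 + w) * ((m + 1 + w) * d - w * m) by field; rewrite gt_eqF.
rewrite -subr_ge0; move: key; rewrite -subr_ge0; congr (_ <= _); rewrite /c; ring.
Qed.

Lemma erlang_quadratic_ge0_step (R : realFieldType) (m w d : R) :
  1 <= m -> 0 < w -> 0 < d ->
  w * (3 * m + 2 + w) <= 2 * (m + 1 + w) * d ->
  0 <= erlang_quadratic m w d ->
  0 <= erlang_quadratic (m + 1) w (m + 1 + w - w * m / d).
Proof.
move=> m1 w0 d0 V P.
(* [al] and [be] are what remains in [E] once the multiple of the old quadratic
   cancelling the constant term is subtracted. *)
pose al := (m ^+ 3 + 5 * m ^+ 2 + 8 * m + 4 + m * w ^+ 2 - 3 * m * w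
            - 2 * m ^+ 2 * w) / 2.
pose be := - (w * m * ((w - m - 1) ^+ 2 + 2 * m + 3)) / 2.
have al0 : 0 < al.
  have -> : al = (m * (w - m - 3 / 2) ^+ 2 + 2 * m ^+ 2 + 23 / 4 * m + 4) / 2.
    by rewrite /al; field.
  have := sqr_ge0 (w - m - 3 / 2); nra.
have E : erlang_quadratic (m + 1) w (m + 1 + w - w * m / d) * d ^+ 2 =
   (m + 2 + w) * m / 2 * erlang_quadratic m w d + d * (al * d + be).
  by rewrite /erlang_quadratic /al /be; field; rewrite gt_eqF.
have Pz : al ^+ 2 * erlang_quadratic m w (- be / al) = - (m * w ^+ 5).
  transitivity ((m + 1 + w) * be ^+ 2 + w * (3 * m + 2 + w) * al * be
                + 2 * m * w ^+ 2 * al ^+ 2).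
    by rewrite /erlang_quadratic; move: (al) (be) al0 => x y x0; field; rewrite gt_eqF.
  by rewrite /al /be; field.
(* By [Pz], [- be / al] is at most the larger root, hence at most [d]. *)
have key : 0 <= al * d + be.
  rewrite leNgt; apply/negP => lt0.
  have dz : d < - be / al by rewrite ltr_pdivlMr// mulrC; lra.
  set z := - be / al in dz Pz.
  (* By [V], [d] is not left of the vertex, and beyond the vertex the quadratic increases. *)
  have : erlang_quadratic m w d < erlang_quadratic m w z.
    rewrite -subr_gt0 [ltRHS](_ : _ = (z - d) *
      ((m + 1 + w) * (z - d) + (2 * (m + 1 + w) * d - w * (3 * m + 2 + w)))).
      by apply: mulr_gt0; [lra|apply: ltr_wpDr; [lra|apply: mulr_gt0; lra]].
    by rewrite /erlang_quadratic; ring.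
  move=> /(le_lt_trans P) /(mulr_gt0 (exprn_gt0 2 al0)); rewrite Pz.
  have : 0 <= m * w ^+ 5 by apply: mulr_ge0; [lra|apply/exprn_ge0/ltW].
  by move=> *; lra.
rewrite -(pmulr_lge0 _ (exprn_gt0 2 d0)) E.
apply: addr_ge0; last by apply: mulr_ge0 => //; exact: ltW.
by apply: mulr_ge0 => //; apply: mulr_ge0; [apply: mulr_ge0; lra|lra].
Qed.

(** * Partial exponential sums and service levels *)

Section exp_sum.
Context {R : realType}.
Implicit Types (n : nat) (w : R).

Lemma exp_sum0 w : exp_sum 0 w = 0. Proof. by rewrite /exp_sum big_geq. Qed.

Lemma exp_sumS n w : exp_sum n.+1 w = exp_sum n w + w ^+ n / n`!%:R.
Proof. by rewrite /exp_sum big_nat_recr. Qed.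

Lemma exp_sum_gt0 n w : 0 <= w -> 0 < exp_sum n.+1 w.
Proof.
move=> w0; rewrite /exp_sum big_nat_recl// expr0 fact0 divr1 ltr_wpDr//.
by apply: sumr_ge0 => i _; apply: divr_ge0; rewrite ?exprn_ge0.
Qed.

Lemma is_derive_exp_sum n w : is_derive w (1 : R) (exp_sum n.+1) (exp_sum n w).
Proof.
elim: n w => [|n IH] w.
  rewrite exp_sum0.
  have -> : exp_sum 1 = cst (1 : R).
    by apply/funext => x; rewrite exp_sumS exp_sum0 add0r expr0 fact0 divr1.
  exact: is_derive_cst.
have -> : exp_sum n.+2 = exp_sum n.+1 + (n.+1`!%:R)^-1 *: (id : R -> R) ^+ n.+1.
  by apply/funext => x; rewrite exp_sumS mulrC exprfctE.
rewrite [X in is_derive _ _ _ X]exp_sumS; apply: is_derive_eq.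
rewrite -[X in _ + X]/(_ * (_ * 1)) factS natrM /=; field.
by rewrite pnatr_eq0 -lt0n fact_gt0 nat1r pnatr_eq0.
Qed.

Definition service_level n w := exp_sum n w / exp_sum n.+1 w.

Lemma service_level0 w : service_level 0 w = 0.
Proof. by rewrite /service_level exp_sum0 mul0r. Qed.

(** The Erlang recursion cleared of its denominator. With the last terms split off, it is a rational
    identity in [exp_sum n w], [w ^+ n], [n.+1] and the factorial. *)
Lemma service_level_rec n w : 0 <= w ->
  service_level n.+1 w * (n.+1%:R + w * (1 - service_level n w)) = n.+1%:R.
Proof.
move=> w0; rewrite /service_level !exp_sumS.
have f0 : 0 < n`!%:R :> R by rewrite ltr0n fact_gt0.
have c0 : 0 < n.+1%:R :> R by rewrite ltr0n.
have := exp_sum_gt0 n.+1 w0; have := exp_sum_gt0 n w0.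
rewrite !exp_sumS factS natrM exprS.
move: (exp_sum n w) (w ^+ n) n.+1%:R n`!%:R c0 f0 => e p c f c0 f0 E1 E2.
field; rewrite !gt_eqF//=.
  rewrite (_ : _ + _ = f * c * (e + p / f + w * p / (c * f))) ?mulr_gt0//.
  by field; rewrite !gt_eqF.
rewrite (_ : _ + _ = f * (e + p / f)) ?mulr_gt0//.
by field; rewrite gt_eqF.
Qed.

Lemma service_level_le1 n w : 0 <= w -> service_level n w <= 1.
Proof.
move=> w0; rewrite /service_level ler_pdivrMr ?exp_sum_gt0// mul1r exp_sumS.
by rewrite lerDl divr_ge0// exprn_ge0.
Qed.

Lemma erlang_quadratic_ge0 n w : 0 < w ->
  let m := n.+1%:R in let d := m + w * (1 - service_level n w) in
  w * (3 * m + 2 + w) <= 2 * (m + 1 + w) * d /\ 0 <= erlang_quadratic m w d.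
Proof.
move=> w0; elim: n => [|n [V P]] /=.
  (* The induction starts at [m = 1], [d = 1 + w], where the quadratic equals 2. *)
  rewrite service_level0 /erlang_quadratic subr0; split; first nra.
  have : 0 < w ^+ 2 by rewrite exprn_gt0.
  nra.
set m : R := n.+1%:R in V P *.
have m1 : 1 <= m by rewrite /m ler1n.
set r := service_level n w in V P *.
have d0 : 0 < m + w * (1 - r).
  by apply: ltr_wpDr; [rewrite mulr_ge0 ?subr_ge0 ?service_level_le1 ?ltW|lra].
have rE : service_level n.+1 w = m / (m + w * (1 - r)).
  exact: canRL (mulfK (lt0r_neq0 d0)) (service_level_rec n (ltW w0)).
have -> : n.+2%:R = m + 1 by rewrite /m -natr1.
have -> : m + 1 + w * (1 - service_level n.+1 w) = m + 1 + w - w * m / (m + w * (1 - r)).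
  by rewrite rE; move: d0; set d := m + w * (1 - r) => d0; field; rewrite gt_eqF.
split; last exact: erlang_quadratic_ge0_step.
have := erlang_quadratic_vertex_step m1 w0 d0 V.
rewrite (_ : m + 1 + 1 + w = m + 2 + w)//; lra.
Qed.

(** Two steps of the recursion express all three levels through [d]; the defect is
    [erlang_quadratic m w d] times a factor that is nonnegative because [d - m = w * (1 - r)]. *)
Lemma service_level_concave n w : 0 < w ->
  service_level n w + service_level n.+2 w <= 2 * service_level n.+1 w.
Proof.
move=> w0; have [_] := erlang_quadratic_ge0 n w0.
have m1 : 1 <= n.+1%:R :> R by rewrite ler1n.
have rle := service_level_le1 n (ltW w0).
have d0 : 0 < n.+1%:R + w * (1 - service_level n w).
  by apply: ltr_wpDr; [rewrite mulr_ge0 ?subr_ge0 ?(ltW w0)|rewrite ltr0n].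
have r1 : service_level n.+1 w = n.+1%:R / (n.+1%:R + w * (1 - service_level n w)).
  exact: canRL (mulfK (lt0r_neq0 d0)) (service_level_rec n (ltW w0)).
have d0' : 0 < n.+2%:R + w * (1 - service_level n.+1 w).
  apply: ltr_wpDr; last by rewrite ltr0n.
  by rewrite mulr_ge0 ?subr_ge0 ?service_level_le1 ?ltW.
have r2 : service_level n.+2 w = n.+2%:R / (n.+2%:R + w * (1 - service_level n.+1 w)).
  exact: canRL (mulfK (lt0r_neq0 d0')) (service_level_rec n.+1 (ltW w0)).
rewrite r2 r1; rewrite r1 in d0'.
have -> : n.+2%:R = n.+1%:R + 1 :> R by rewrite -natr1.
have {}d0' : 0 < n.+1%:R + 1 + w * (1 - n.+1%:R / (n.+1%:R + w * (1 - service_level n w))).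
  by move: d0'; rewrite (_ : n.+2%:R = n.+1%:R + 1 :> R)// -natr1.
move: (n.+1%:R) (service_level n w) m1 rle d0 d0' => m r m1 rle d0 d0'.
set d := m + w * (1 - r) in d0 d0' *.
have -> : r = 1 - (d - m) / w by rewrite /d; field; rewrite gt_eqF.
have d1 : 0 < (m + 1 + w) * d - w * m.
  have -> : (m + 1 + w) * d - w * m = (m + 1 + w * (1 - m / d)) * d.
    by field; rewrite gt_eqF.
  exact: mulr_gt0.
rewrite /erlang_quadratic => P.
have dm : 0 <= d - m by rewrite /d addrC addKr mulr_ge0 ?subr_ge0 ?(ltW w0).
rewrite -subr_ge0 (_ : _ - _ =
    (d - m) / w * (erlang_quadratic m w d / (d * ((m + 1 + w) * d - w * m)))).
  by rewrite mulr_ge0 ?divr_ge0 ?mulr_ge0 // ltW.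
rewrite (_ : m + 1 + w * (1 - m / d) = ((m + 1 + w) * d - w * m) / d); last first.
  by field; rewrite gt_eqF.
by rewrite /erlang_quadratic; field; rewrite !gt_eqF.
Qed.

End exp_sum.

(** * Supporting lines and the sign of the derivative *)

(** In the weighted sum of the two hypotheses the slope terms cancel. *)
Lemma supporting_line_jensen (R : realDomainType) (f : R -> R) (s t x y : R) :
  0 <= t <= 1 -> let z := t * x + (1 - t) * y in
  f z + s * (x - z) <= f x -> f z + s * (y - z) <= f y ->
  f z <= t * f x + (1 - t) * f y.
Proof.
move=> /andP[t0 t1] z fx fy.
have hx := ler_wpM2l t0 fx; have t1' : 0 <= 1 - t by rewrite subr_ge0.
have := lerD hx (ler_wpM2l t1' fy); congr (_ <= _).
rewrite /z; ring.
Qed.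

Section derive_sign.
Context {R : realType}.
Implicit Types f df : R -> R.

Lemma is_derive_within_continuous f df (A : set R) :
  (forall x, A x -> is_derive x (1 : R) f (df x)) -> {within A, continuous f}.
Proof.
move=> fdf; apply: continuous_in_subspaceT => x /set_mem Ax.
by apply: differentiable_continuous; apply/derivable1_diffP; have [] := fdf _ Ax.
Qed.

(** Only continuity is asked at the end points, so that [vlow K] can be one of them. *)
Lemma is_derive_le0_le f df (a b : R) : a <= b ->
  {within `[a, b], continuous f} ->
  (forall x, a < x < b -> is_derive x (1 : R) f (df x)) ->
  (forall x, a < x < b -> df x <= 0) -> f b <= f a.
Proof.
rewrite le_eqVlt => /predU1P[->//|ab] cf fdf df0.
have fdf' x : x \in `]a, b[ -> is_derive x (1 : R) f (df x).
  by rewrite in_itv/=; exact: fdf.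
have [x xab E] := MVT ab fdf' cf.
rewrite -subr_le0 E mulr_le0_ge0 ?subr_ge0 ?(ltW ab)//.
by apply: df0; rewrite in_itv in xab.
Qed.

Lemma is_derive_ge0_le f df (a b : R) : a <= b ->
  {within `[a, b], continuous f} ->
  (forall x, a < x < b -> is_derive x (1 : R) f (df x)) ->
  (forall x, a < x < b -> 0 <= df x) -> f a <= f b.
Proof.
rewrite le_eqVlt => /predU1P[->//|ab] cf fdf df0.
have fdf' x : x \in `]a, b[ -> is_derive x (1 : R) f (df x).
  by rewrite in_itv/=; exact: fdf.
have [x xab E] := MVT ab fdf' cf.
rewrite -subr_ge0 E mulr_ge0 ?subr_ge0 ?(ltW ab)//.
by apply: df0; rewrite in_itv in xab.
Qed.

(** By the mean value theorem the chord slope is [df c] with [c] between [x] and [y]; monotonicity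
    compares it with [df x]. *)
Lemma is_derive_supporting_line f df (a x y : R) :
  (forall z, a <= z -> is_derive z (1 : R) f (df z)) ->
  {in `[a, +oo[ &, {homo df : u v / u <= v}} ->
  a <= x -> a <= y -> f x + df x * (y - x) <= f y.
Proof.
move=> fdf mdf ax ay.
have cf u v : a <= u -> {within `[u, v], continuous f}.
  move=> au; apply: (is_derive_within_continuous (df := df)) => z /=.
  by rewrite in_itv/= => /andP[uz _]; apply: fdf; exact: le_trans uz.
have [xy|/ltW yx] := leP x y.
  have fdf' z : z \in `]x, y[ -> is_derive z (1 : R) f (df z).
    by rewrite in_itv/= => /andP[xz _]; apply/fdf/ltW/(le_lt_trans ax).
  have [c] := MVT_segment xy fdf' (cf _ y ax).
  rewrite in_itv/= => /andP[xc cy] E; rewrite -lerBrDl E.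
  apply: ler_wpM2r; first by rewrite subr_ge0.
  by apply: mdf; rewrite // in_itv/= andbT// (le_trans ax).
have fdf' z : z \in `]y, x[ -> is_derive z (1 : R) f (df z).
  by rewrite in_itv/= => /andP[xz _]; apply/fdf/ltW/(le_lt_trans ay).
have [c] := MVT_segment yx fdf' (cf _ x ay).
rewrite in_itv/= => /andP[yc cx] E.
have : df c * (x - y) <= df x * (x - y).
  apply: ler_wpM2r; first by rewrite subr_ge0.
  by apply: mdf; rewrite // in_itv/= andbT// (le_trans ay).
by rewrite -E; nra.
Qed.

End derive_sign.

(** * Supporting lines of the denominator *)

Section QC.
Context {R : realType}.
Implicit Types (n : nat) (w : R).

(** The subtracted term is [service_level n w / service_level n.+1 w]. *)
Lemma is_derive_QC n w : 0 <= w ->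
  is_derive w (1 : R) (QC n.+1)
    (1 - exp_sum n.+2 w * exp_sum n w / exp_sum n.+1 w ^+ 2).
Proof.
move=> w0; have E1 := exp_sum_gt0 n w0.
have E0 : exp_sum n.+1 w != 0 by rewrite gt_eqF.
have d1 := is_derive_exp_sum n w; have d2 := is_derive_exp_sum n.+1 w.
have dV := is_deriveV E0 d1.
rewrite (_ : QC n.+1 = exp_sum n.+2 * (fun y => (exp_sum n.+1 y)^-1)); last first.
  by apply/funext.
apply: is_derive_eq; rewrite /GRing.scale/=.
by field.
Qed.

Lemma QC_derivative_nondecreasing n :
  {in `[0, +oo[ &, {homo (fun w : R =>
    1 - exp_sum n.+2 w * exp_sum n w / exp_sum n.+1 w ^+ 2) : u v / u <= v}}.
Proof.
(* For a single unit [exp_sum 0 w = 0] and the derivative is constantly 1. Otherwise all three sums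
   have successor length and [is_derive_exp_sum] applies. *)
case: n => [|n] u v; rewrite !in_itv/= !andbT => u0 v0 uv.
  by rewrite !exp_sum0 !mulr0 !mul0r.
rewrite lerD2l lerN2.
pose g := exp_sum n.+3 * exp_sum n.+1 * (fun w : R => (exp_sum n.+2 w)^-1) ^+ 2.
pose dg w := (exp_sum n.+1 w * exp_sum n.+2 w ^+ 2
  + exp_sum n.+3 w * exp_sum n w * exp_sum n.+2 w
  - 2 * exp_sum n.+3 w * exp_sum n.+1 w ^+ 2) / exp_sum n.+2 w ^+ 3.
have gdg w : 0 <= w -> is_derive w (1 : R) g (dg w).
  move=> w0; have E0 : exp_sum n.+2 w != 0 by rewrite gt_eqF ?exp_sum_gt0.
  have d1 := is_derive_exp_sum n w; have d2 := is_derive_exp_sum n.+1 w.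
  have d3 := is_derive_exp_sum n.+2 w; have dV := is_deriveV E0 d2.
  apply: is_derive_eq; rewrite /GRing.scale/= /dg.
  by rewrite !fctE /=; field.
have gE w : exp_sum n.+3 w * exp_sum n.+1 w / exp_sum n.+2 w ^+ 2 = g w.
  by rewrite /g !fctE exprVn.
rewrite !gE.
apply: (@is_derive_le0_le _ g dg u v uv).
- apply: (@is_derive_within_continuous _ g dg) => z /=.
  by rewrite in_itv/= => /andP[uz _]; apply: gdg; exact: le_trans uz.
- by move=> z /andP[uz _]; apply/gdg/ltW/(le_lt_trans u0).
move=> w /andP[uw _]; have w0 := le_lt_trans u0 uw.
have := service_level_concave n w0; rewrite /service_level /dg.
have E1 := exp_sum_gt0 n (ltW w0); have E2 := exp_sum_gt0 n.+1 (ltW w0).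
have E3 := exp_sum_gt0 n.+2 (ltW w0).
rewrite -subr_ge0 => h.
(* [- dg w] is the concavity defect [h] times a positive quotient of sums. *)
rewrite -oppr_ge0 [leRHS](_ : _ =
  (2 * (exp_sum n.+1 w / exp_sum n.+2 w) - (exp_sum n w / exp_sum n.+1 w +
   exp_sum n.+2 w / exp_sum n.+3 w)) * (exp_sum n.+1 w * exp_sum n.+3 w / exp_sum n.+2 w ^+ 2)).
  by apply: mulr_ge0 => //; rewrite divr_ge0 ?mulr_ge0 ?exprn_ge0 ?ltW.
by field; rewrite !gt_eqF.
Qed.

Lemma QC_supporting_line n (x y : R) : 0 <= x -> 0 <= y ->
  QC n.+1 x + (1 - exp_sum n.+2 x * exp_sum n x / exp_sum n.+1 x ^+ 2) * (y - x)
    <= QC n.+1 y.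
Proof.
by move=> x0 y0; apply: (is_derive_supporting_line (@is_derive_QC n)
  (@QC_derivative_nondecreasing n) x0 y0).
Qed.

End QC.

(** * Revenue of a single class *)

(* Such a [g] is concave, so near [a] it is monotone: nonincreasing on the whole
   interval, or else nondecreasing to the left of any [x] with [g x < g y] for
   some [y > x]. It is bounded above by any of its supporting lines. *)
Lemma supporting_line_cvg_at_right (R : realType) (g : R -> R) (a b : R) :
  a < b -> (forall x, a < x < b -> 0 <= g x) ->
  (forall x, a < x < b -> exists s,
    forall y, a < y < b -> g y <= g x + s * (y - x)) ->
  cvg (g x @[x --> a^'+]).
Proof.
move=> ab g0 gs.
have [nig|] := pselect (forall x y, a < x < b -> a < y < b -> x <= y -> g y <= g x).
  have cab : a < (a + b) / 2 < b by rewrite !midf_lt.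
  have [s hs] := gs _ cab.
  apply/cvg_ex; eexists; apply: (@nonincreasing_at_right_cvgr _ g a (BLeft b)).
  - by rewrite bnd_simp.
  - by move=> x y; rewrite !in_itv/= => xab yab xy; exact: nig.
  exists (g ((a + b) / 2) + `|s| * (b - a)) => _ [y + <-]; rewrite /= in_itv/= => yab.
  apply: le_trans (hs _ yab) _; rewrite lerD2l; apply: le_trans (ler_norm _) _.
  rewrite normrM ler_wpM2l// ler_norml; move/andP: yab => [? ?].
  by move/andP: cab => [? ?]; apply/andP; split; lra.
move=> /existsNP[x] /existsNP[y] /not_implyP[/[dup] xab /andP[ax xb]].
move=> /not_implyP[yab] /not_implyP[xy] /negP; rewrite -ltNge => gxy.
have [sx hx] := gs _ xab.
have sx0 : 0 < sx by have := hx _ yab; move: gxy xy; nra.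
apply/cvg_ex; eexists; apply: (@nondecreasing_at_right_cvgr _ g a (BLeft x)).
- by rewrite bnd_simp.
- move=> u v; rewrite !in_itv/= => /andP[au ux] /andP[av vx] uv.
  have uab : a < u < b by rewrite au (lt_trans ux).
  have vab : a < v < b by rewrite av (lt_trans vx).
  have [s hs] := gs _ vab.
  (* Adding the lines at [x] and [v] gives [0 <= (s - sx) * (x - v)]; so [s] is positive and the
     line at [v] yields [g u <= g v]. *)
  have := hs _ xab; have := hx _ vab; have := hs _ uab.
  move=> h1 h2 h3; have : sx <= s.
    by rewrite -(ler_pM2r (_ : 0 < x - v)) ?subr_gt0//; lra.
  by nra.
exists 0 => _ [u + <-]; rewrite /= in_itv/= => /andP[au ux].
by apply: g0; rewrite au (lt_trans ux).
Qed.

Section customer_class.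
Context {R : realType} (K : customer_class R).

Local Notation L := (arrival_rate K).
Local Notation F := (val_cdf K).
Local Notation f := (val_pdf K).

Lemma val_cdf_continuous (a b : R) : vlow K <= a -> (b%:E < vhigh K)%E ->
  {within `[a, b], continuous F}.
Proof.
move=> ha hb; have [ab|ba|<-] := ltgtP a b; last 2 first.
- by rewrite set_itv_ge ?bnd_simp -?ltNge//; exact: continuous_subspace0.
- by rewrite set_itv1; exact: continuous_subspace1.
have cF x : a < x -> x <= b -> {for x, continuous F}.
  move=> ax xb; apply: differentiable_continuous; apply/derivable1_diffP.
  have [] // := @cdf_derive _ K x (le_lt_trans ha ax).
  by apply: le_lt_trans hb; rewrite lee_fin.
apply/continuous_within_itvP => //; split.
- by move=> x; rewrite in_itv/= => /andP[ax xb]; apply: cF => //; exact: ltW.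
(* [a] may be [vlow K], where no derivative is given. *)
- exact: cumulative_is_right_continuous.
- exact/cvg_at_left_filter/cF.
Qed.

(** Supplies the right end point for the intermediate value theorem in [priceP]. *)
Lemma val_cdf_near_vhigh (e : R) : e < 1 ->
  exists x, [/\ vlow K < x, (x%:E < vhigh K)%E & e < F x].
Proof.
move=> e1; have vlv := vlow_lt_vhigh K.
case E : (vhigh K) vlv => [b| |] vlv //; last first.
  near (pinfty_nbhs R) => x; exists x; split => //.
    exact: ltry.
  by near: x; apply: cvgr_gt e1; exact: cumulativey.
rewrite lte_fin in vlv.
(* [cdf_derive] says nothing at a finite [vhigh K]; left continuity there comes
   from the density. *)
pose I i := `]-oo, (b - i.+1%:R^-1)]%classic.
have I_cvg : (\int[lebesgue_measure]_(t in I i) (f t)%:E)%E @[i --> \oo] -->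
    (\int[lebesgue_measure]_(t in \bigcup_i I i) (f t)%:E)%E.
  apply: ge0_nondecreasing_set_cvg_integral.
  - move=> m n mn; rewrite subsetEset; apply: subset_itvl; rewrite bnd_simp lerD2l lerN2.
    by rewrite lef_pV2 ?posrE// ler_nat ltnS.
  - by move=> i; exact: measurable_itv.
  - move=> i; apply/measurable_realfun.measurable_EFinP.
    by apply: measurable_funTS; exact: pdf_measurable.
  - by move=> i x _; rewrite lee_fin pdf_ge0.
have UI : \bigcup_i I i = `]-oo, b[%classic.
  apply/seteqP; split => x /=.
    by move=> [i _] /=; rewrite /I/= !in_itv/= => /le_lt_trans; apply; rewrite gtrBl.
  rewrite in_itv/= -subr_gt0 => xb.
  near \oo => n; exists n => //; rewrite /I/= in_itv/= lerBrDr -lerBrDl.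
  by apply/ltW; near: n; exact: near_infty_natSinv_lt (PosNum xb).
(* The point [b] is null, so the limit integral is [F b = 1]. *)
move: I_cvg; rewrite UI integral_itv_bndo_bndc; last first.
  apply/measurable_realfun.measurable_EFinP.
  by apply: measurable_funTS; exact: pdf_measurable.
rewrite -cdf_pdf cdf_high ?E// => /fine_cvg /cvgr_gt /(_ e e1) I_gt.
near \oo => n; exists (b - n.+1%:R^-1); split.
- rewrite ltrBrDr -ltrBrDl; near: n.
  have bv : 0 < b - vlow K by rewrite subr_gt0.
  exact: near_infty_natSinv_lt (PosNum bv).
- by rewrite lte_fin gtrBl.
- have : e < fine (\int[lebesgue_measure]_(t in I n) (f t)%:E)%E by near: n.
  by rewrite /I -cdf_pdf.
Unshelve. all: by end_near. Qed.

Lemma priceP (l : R) : 0 < l < L ->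
  exists p, [/\ vlow K < p, (p%:E < vhigh K)%E, L * (1 - F p) = l
              & price K l = p%:E].
Proof.
move=> /andP[l0 lL]; have L0 := arrival_rate_gt0 K.
rewrite /price gt_eqF//= lt_eqF//=.
suff : exists x, [/\ vlow K < x, (x%:E < vhigh K)%E & L * (1 - F x) = l].
  by move=> /(@xgetPex _ (0 : R))[]; eexists; split; last reflexivity.
have [b [vb bv lb]] : exists x, [/\ vlow K < x, (x%:E < vhigh K)%E & 1 - l / L < F x].
  by apply: val_cdf_near_vhigh; rewrite gtrBl divr_gt0.
have Fv : F (vlow K) = 0 by rewrite cdf_low.
have lL1 : 0 < 1 - l / L by rewrite subr_gt0 ltr_pdivrMr// mul1r.
have [||x] := @IVT R F (vlow K) b (1 - l / L) (ltW vb).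
- exact: val_cdf_continuous.
- by rewrite Fv ge_min le_max (ltW lL1) (ltW lb) orbT.
rewrite in_itv/= => /andP[vx xb] Fx; exists x; split.
- rewrite lt_neqAle vx andbT; apply/eqP => vxE.
  by move: Fx lL1; rewrite -vxE Fv => ->; rewrite ltxx.
- by apply: le_lt_trans bv; rewrite lee_fin.
- by rewrite Fx; field; rewrite gt_eqF.
Qed.

Lemma revenue_interior (l : R) : 0 < l < L -> revenue K l = l * fine (price K l).
Proof. by move=> /andP[l0 _]; rewrite /revenue gt_eqF. Qed.

Lemma price_supporting_line (p x : R) : regular K ->
  vlow K < p -> (p%:E < vhigh K)%E -> vlow K <= x -> (x%:E < vhigh K)%E ->
  L * (1 - F x) * (x - virtual_value K p) <=
  L * (1 - F p) * (p - virtual_value K p).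
Proof.
move=> hreg vp pv vx xv; set s := virtual_value K p.
pose H := (L *: (cst 1 - (F : R -> R))) * (id - cst s).
pose dH (y : R) := - (L * f y * (virtual_value K y - s)).
have HdH y : vlow K < y -> (y%:E < vhigh K)%E -> is_derive y (1 : R) H (dH y).
  move=> vy yv; have dF := cdf_derive vy yv.
  apply: is_derive_eq; rewrite /GRing.scale /= /dH /virtual_value !fctE/=.
  by rewrite -[L *: _]/(L * _); field; rewrite gt_eqF// pdf_gt0.
have cH a b : vlow K <= a -> (b%:E < vhigh K)%E -> {within `[a, b], continuous H}.
  move=> va bv y; apply: cvgM.
    by apply: cvgZr; apply: cvgB; [exact: cvg_cst|exact: val_cdf_continuous].
  have : {within `[a, b], continuous (id - cst s : R -> R)}.
    by apply: continuous_subspaceT => z; apply: cvgB; [exact: cvg_id|exact: cvg_cst].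
  exact.
rewrite -[leLHS]/(H x) -[leRHS]/(H p).
have Lf0 y : vlow K < y -> (y%:E < vhigh K)%E -> 0 <= L * f y.
  by move=> vy yv; rewrite mulr_ge0 ?pdf_ge0// ltW// arrival_rate_gt0.
(* [virtual_value K y - s] changes sign at [p]: [H] increases up to [p] and decreases after it. *)
have [xp|/ltW px] := leP x p.
  apply: (@is_derive_ge0_le _ H dH) => //; first exact: cH.
    move=> y /andP[xy yp]; apply: HdH; first exact: le_lt_trans xy.
    by apply: lt_trans pv; rewrite lte_fin.
  move=> y /andP[xy yp]; rewrite /dH -mulrN mulr_ge0//.
    apply: Lf0; first exact: le_lt_trans xy.
    by apply: lt_trans pv; rewrite lte_fin.
  rewrite opprB subr_ge0; apply: hreg => //; last exact: ltW.
  exact: le_lt_trans xy.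
apply: (@is_derive_le0_le _ H dH) => //; first by apply: cH => //; exact: ltW.
  move=> y /andP[py yx]; apply: HdH; first exact: lt_trans py.
  by apply: lt_trans xv; rewrite lte_fin.
move=> y /andP[py yx]; have yv : (y%:E < vhigh K)%E.
  by apply: lt_trans xv; rewrite lte_fin.
rewrite /dH oppr_le0 mulr_ge0//; first by apply: Lf0 => //; exact: lt_trans py.
by rewrite subr_ge0; apply: hreg => //; exact: ltW.
Qed.

(** The slope is the virtual value at the price [p] of [l0]. The intercept at rate 0 is then
    [l0 * (1 - F p) / f p]; rate [L] corresponds to the price [vlow K]. *)
Lemma revenue_interior_supporting_line (l0 : R) : regular K -> 0 < l0 < L ->
  exists s, [/\ 0 <= revenue K l0 - s * l0,
   revenue K L <= revenue K l0 + s * (L - l0) &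
   forall l, 0 < l < L -> revenue K l <= revenue K l0 + s * (l - l0)].
Proof.
move=> hreg l0L; have [p [vp pv pE pK]] := priceP l0L.
have L0 := arrival_rate_gt0 K.
exists (virtual_value K p); rewrite (revenue_interior l0L) pK/=.
have Fp : 1 - F p = l0 / L by rewrite -pE mulrC mulKf ?gt_eqF.
split.
- rewrite mulrC -mulrBl /virtual_value opprD addNKr opprK; move/andP: l0L => [l00 _].
  by rewrite mulr_ge0 ?(ltW l00)// Fp divr_ge0 ?pdf_ge0// divr_ge0 ?ltW.
- rewrite /revenue /price gt_eqF//= eqxx/=.
  have := price_supporting_line hreg vp pv (lexx _) (vlow_lt_vhigh K).
  by rewrite (cdf_low (lexx (vlow K))) pE; lra.
- move=> l lL; rewrite (revenue_interior lL).
  have [q [vq qv qE ->]] := priceP lL.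
  by have := price_supporting_line hreg vp pv (ltW vq) qv; rewrite /= qE pE; lra.
Qed.

Lemma revenue_interior_ge0 (l : R) : 0 < l < L -> 0 <= revenue K l.
Proof.
move=> lL; rewrite (revenue_interior lL); have [p [vp _ _ ->]] := priceP lL.
move/andP: lL => [l0 _]; apply: mulr_ge0; first exact: ltW.
exact/ltW/(le_lt_trans (vlow_ge0 K)).
Qed.

(** Makes the [lim] in [revenue] a genuine limit, so that inequalities on the open interval pass to
    rate 0. *)
Lemma revenue_cvg0 : regular K -> cvg (l * fine (price K l) @[l --> 0^'+]).
Proof.
move=> hreg; apply: (supporting_line_cvg_at_right (arrival_rate_gt0 K)).
  by move=> l lL; rewrite -revenue_interior//; exact: revenue_interior_ge0.
move=> l lL; have [s [_ _ sl]] := revenue_interior_supporting_line hreg lL.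
by exists s => y yL; rewrite -!revenue_interior//; exact: sl.
Qed.

Lemma revenue_ge0 (l : R) : regular K -> 0 <= l <= L -> 0 <= revenue K l.
Proof.
move=> hreg /andP[]; rewrite le_eqVlt => /predU1P[<- _|l0].
  rewrite /revenue eqxx/=; case: ifPn => _; last by rewrite mul0r.
  apply: limr_ge; first exact: revenue_cvg0.
  near=> x; have xL : 0 < x < L.
    by apply/andP; split => //; near: x; apply: nbhs_right_lt; exact: arrival_rate_gt0.
  by rewrite -revenue_interior//; exact: revenue_interior_ge0.
rewrite le_eqVlt => /predU1P[->|lL]; last by apply: revenue_interior_ge0; rewrite l0.
rewrite /revenue /price gt_eqF ?arrival_rate_gt0//= eqxx.
by rewrite mulr_ge0// ?vlow_ge0// ltW// arrival_rate_gt0.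
Unshelve. all: by end_near. Qed.

Lemma revenue_supporting_line (l0 : R) : regular K -> 0 < l0 < L ->
  exists s, forall l, 0 <= l <= L -> revenue K l <= revenue K l0 + s * (l - l0).
Proof.
move=> hreg l0L; have L0 := arrival_rate_gt0 K.
have [s [s0 sL sl]] := revenue_interior_supporting_line hreg l0L.
exists s => l /andP[]; rewrite le_eqVlt => /predU1P[<- _|lgt0]; last first.
  by rewrite le_eqVlt => /predU1P[->//|lL]; apply: sl; rewrite lgt0.
(* If [vhigh K] is finite, the revenue at 0 is 0, at most the intercept; if it is infinite, the
   interior inequality passes to the limit. *)
rewrite sub0r mulrN {1}/revenue eqxx/=; case: ifPn => _; last by rewrite mul0r.
have g_cvg : l * fine (price K l) - s * l @[l --> 0^'+] -->
    lim (l * fine (price K l) @[l --> 0^'+]) - s * 0.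
  apply: cvgB; first exact: revenue_cvg0.
  by apply: cvgMr; apply: cvg_at_right_filter; exact: cvg_id.
rewrite mulr0 subr0 in g_cvg; rewrite -(cvg_lim _ g_cvg)//.
apply: limr_le; first by apply/cvg_ex; eexists; exact: g_cvg.
near=> x; have xL : 0 < x < L.
  by apply/andP; split => //; near: x; exact: nbhs_right_lt.
rewrite -revenue_interior//.
by have := sl _ xL; lra.
Unshelve. all: by end_near. Qed.

(** Supporting lines are available at interior rates; apart from [t = 0], [t = 1] and [x = y], the
    mixture is such a rate. *)
Lemma revenue_concave (t x y : R) : regular K ->
  0 <= t <= 1 -> 0 <= x <= L -> 0 <= y <= L ->
  t * revenue K x + (1 - t) * revenue K y <= revenue K (t * x + (1 - t) * y).
Proof.
move=> hreg /[dup] t01 /andP[]; rewrite le_eqVlt => /predU1P[<-|t0].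
  by rewrite subr0 !mul0r !mul1r !add0r.
rewrite le_eqVlt => /predU1P[->|t1].
  by rewrite subrr !mul0r !mul1r !addr0.
move=> /[dup] xL /andP[x0 xL'] /[dup] yL /andP[y0 yL'].
have [->|xy] := eqVneq x y; first by rewrite -!mulrDl [t + _]addrC subrK !mul1r.
have zL : 0 < t * x + (1 - t) * y < L.
  have := xy; rewrite neq_lt => /orP[] ?; apply/andP; split; nra.
have [s sl] := revenue_supporting_line hreg zL.
rewrite -lerN2 opprD -!mulrN.
apply: (@supporting_line_jensen _ (fun l => - revenue K l) (- s)) => //.
  by have := sl _ xL; lra.
by have := sl _ yL; lra.
Qed.

End customer_class.

(** * Aggregation over classes and the fractional program *)

Lemma QC_convex (R : realType) n (t x y : R) :
  0 <= t <= 1 -> 0 <= x -> 0 <= y ->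
  QC n.+1 (t * x + (1 - t) * y) <= t * QC n.+1 x + (1 - t) * QC n.+1 y.
Proof.
move=> t01 x0 y0; have z0 : 0 <= t * x + (1 - t) * y.
  by case/andP: t01 => ? ?; rewrite addr_ge0 ?mulr_ge0 ?subr_ge0.
exact: (supporting_line_jensen (f := QC n.+1) t01
  (QC_supporting_line n z0 x0) (QC_supporting_line n z0 y0)).
Qed.

Section load.
Context {R : realType} {M : nat} (K : 'I_M -> customer_class R).
Implicit Types l : 'rV[R]_M.

Lemma load_convex_comb (t : R) l1 l2 :
  load K (t *: l1 + (1 - t) *: l2) = t * load K l1 + (1 - t) * load K l2.
Proof.
rewrite /load !big_distrr -big_split; apply: eq_bigr => j _ /=.
by rewrite !mxE mulrDl !mulrA.
Qed.

Lemma load_ge0 l : (forall j, 0 <= l 0 j) -> 0 <= load K l.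
Proof.
move=> l0; apply: sumr_ge0 => j _.
by apply: divr_ge0 => //; exact/ltW/service_rate_gt0.
Qed.

End load.

Theorem theorem4 (R : realType) (C M : nat) (hC : (1 <= C)%N) (hM : (1 <= M)%N)
    (K : 'I_M -> customer_class R) (hreg : forall j, regular (K j))
    (lbar : 'I_M -> R)
    (hlbar : forall j,
       is_argmax `[0, arrival_rate (K j)] (revenue (K j)) (lbar j)) :
  concave_fractional_program
    [set l : 'rV[R]_M | forall j, 0 <= l 0 j <= lbar j]
    (static_revenue C K)
    (total_revenue K)
    (fun l => QC C (load K l)).
Proof.
case: C hC => [//|C] _.
have i01 (t : {i01 R}) : 0 <= t%:num <= 1 by rewrite ge0 le1.
(* A maximizer lies in its domain, so the box is contained in the region where each revenue is
   concave. *)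
have lL (l : 'rV[R]_M) : (forall j, 0 <= l 0 j <= lbar j) ->
    forall j, 0 <= l 0 j <= arrival_rate (K j).
  move=> hl j; have /andP[-> lb] := hl j; have [+ _] := hlbar j.
  by rewrite /= in_itv/= => /andP[_ /(le_trans lb)].
have ld0 (l : 'rV[R]_M) : (forall j, 0 <= l 0 j <= lbar j) -> 0 <= load K l.
  by move=> hl; apply: load_ge0 => j; case/andP: (hl j).
split.
- by move=> l /= hl; rewrite /static_revenue /QC invf_div.
- move=> x y t /set_mem hx /set_mem hy; apply/mem_set => j.
  rewrite !mxE; have /andP[t0 t1] := i01 t.
  have /andP[x0 xb] := hx j; have /andP[y0 yb] := hy j; apply/andP.
  have t1' : 0 <= 1 - t%:num by rewrite subr_ge0.
  split; first by rewrite addr_ge0 ?mulr_ge0.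
  have := lerD (ler_wpM2l t0 xb) (ler_wpM2l t1' yb); congr (_ <= _); ring.
- move=> t x y /set_mem hx /set_mem hy; rewrite convRE /total_revenue.
  rewrite !mulrN -opprD lerN2 !big_distrr -big_split; apply: ler_sum => j _ /=.
  rewrite !mxE; apply: revenue_concave => //; exact: lL.
- by move=> l hl; apply: sumr_ge0 => j _; apply: revenue_ge0 => //; exact: lL.
(* The load is linear, so convexity of [QC] carries over. *)
- move=> t x y /set_mem hx /set_mem hy; rewrite convRE load_convex_comb.
  by apply: QC_convex => //; exact: ld0.
- by move=> l hl; rewrite divr_gt0// exp_sum_gt0// ld0.
Qed.
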